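(* Let $\Sigma,\Sigma'$ be complete fans in $N_{\mathbb{R}}$ and $N'_{\mathbb{R}}$ respectively, let $A:N\to N'$ be a homomorphism of lattices such that $A\otimes_{\mathbb{Z}}\mathbb{R}$ is surjective, and let $f_A:X(\Sigma)\dashrightarrow X(\Sigma')$ be the dominant toric rational map induced by $A$. Let $D$ be a $T$-invariant Cartier divisor on $X(\Sigma')$ with support function $\psi_D$. Then the pull back of $D$ via $f_A$ is the Weil divisor $$f_A^*D=\sum_{\tau_i\in\Sigma(1)}-\psi_D(Av_i)\cdot V(\tau_i),$$ where the $\tau_i$ run through all one-dimensional cones of $\Sigma$, and $v_i$ is the ray generator of $\tau_i$.
   Context: $N,N'$ are lattices of finite rank, $N_{\mathbb{R}}=N\otimes\mathbb{R}$. Cones are strongly convex rational polyhedral cones; fans are finite; a fan is complete if the union of its cones is the whole space. $X(\Sigma)$ is the complex toric variety of $\Sigma$; $\Sigma(1)$ is the set of rays (one-dimensional cones); the ray generator of a ray is its nonzero lattice point of smallest norm; $V(\tau)$ is the torus-invariant prime divisor that is the closure of the orbit corresponding to the ray $\tau$. A $T$-Cartier divisor $D$ on a complete toric variety of dimension $n$, with dual lattice $M$, is given by elements $u(\sigma)\in M$ for each maximal cone $\sigma\in\Sigma(n)$, compatible on intersections of cones, with $D$ locally defined on the affine chart $U_\sigma$ by $\chi^{-u(\sigma)}$. Its support function $\psi_D$ is the continuous piecewise linear function with $\psi_D(v)=\langle u(\sigma),v\rangle$ for $v\in\sigma$; the associated Weil divisor is $[D]=\sum_i -\psi_D(v_i)V(\tau_i)$.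 Pull back: choose a refinement $\widetilde\Sigma$ of $\Sigma$ such that $A$ maps every cone of $\widetilde\Sigma$ into some cone of $\Sigma'$. Let $\pi:X(\widetilde\Sigma)\to X(\Sigma)$ be the proper birational toric morphism induced by the identity of $N$ and $\widetilde f_A:X(\widetilde\Sigma)\to X(\Sigma')$ the toric morphism induced by $A$. The pull back is $f_A^*D:=\pi_*(\widetilde f_A^*D)$ (a Weil divisor on $X(\Sigma)$). *)

(* Defs.v *)
From HB Require Import structures.
From mathcomp Require Import all_boot all_order all_algebra.
From mathcomp Require Import boolp classical_sets functions cardinality fsbigop.
From mathcomp Require Import reals complex.

Set Implicit Arguments.
Unset Strict Implicit.
Unset Printing Implicit Defensive.

Import Order.TTheory GRing.Theory Num.Theory.

Local Open Scope classical_set_scope.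
Local Open Scope ring_scope.

(* Conventions: N = Z^n is the type of integer row vectors, its dual M the type
   of integer column vectors, and N_R the type of real row vectors.
   A homomorphism A : N -> N' is an integer matrix acting by v |-> v *m A;
   its transpose M' -> M is m |-> A *m m. *)

Definition extR {R : realType} {p q : nat} (B : 'M[int]_(p, q)) : 'M[R]_(p, q) :=
  map_mx intr B.

Definition pairing {R : realType} {n : nat} (u : 'cV[R]_n) (v : 'rV[R]_n) : R :=
  (v *m u) 0 0.

Section Cones.
Context {R : realType} {n : nat}.
Implicit Types s t : set 'rV[R]_n.

Definition cone_gen (k : nat) (G : 'M[int]_(k, n)) : set 'rV[R]_n :=
  [set v | exists c : 'rV[R]_k, (forall i, 0 <= c 0 i) /\ v = c *m extR G].

Definition is_cone s :=
  (exists (k : nat) (G : 'M[int]_(k, n)), s = cone_gen G) /\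
  (forall v, s v -> s (- v) -> v = 0).

Definition is_face t s :=
  exists u : 'cV[R]_n, (forall v, s v -> 0 <= pairing u v) /\
    t = s `&` [set v | pairing u v = 0].

(* The linear span of s has dimension d: s contains a basis of its span. *)
Definition has_dim s (d : nat) :=
  exists B : 'M[R]_(d, n),
    [/\ row_free B, forall i, s (row i B) & forall v, s v -> (v <= B)%MS].

(* S_s, the lattice points of the dual cone *)
Definition dual_monoid s : set 'cV[int]_n :=
  [set m | forall v, s v -> 0 <= pairing (extR m) v].

Definition perp s : set 'cV[int]_n :=
  [set m | forall v, s v -> pairing (extR m) v = 0].

Definition sq_norm (v : 'rV[int]_n) : int := \sum_j v 0 j ^+ 2.

Definition is_ray_generator s (v : 'rV[int]_n) :=
  [/\ s (extR v), v != 0 &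
      forall w, s (extR w) -> w != 0 -> sq_norm v <= sq_norm w].

Definition ray_generator s : 'rV[int]_n := xget 0 (is_ray_generator s).

End Cones.

Record fan (R : realType) (n : nat) := Fan {
  cones :> set (set 'rV[R]_n);
  fan_finite : finite_set cones;
  fan_cone : forall s, cones s -> is_cone s;
  fan_face : forall s t, cones s -> is_face t s -> cones t;
  fan_meet : forall s t, cones s -> cones t -> is_face (s `&` t) s
}.

Section Fans.
Context {R : realType} {n : nat}.
Implicit Type F : fan R n.

Definition support F : set 'rV[R]_n := [set v | exists2 s, cones F s & s v].

Definition complete F := support F = setT.

Definition rays F : set (set 'rV[R]_n) := [set s | cones F s /\ has_dim s 1].

(* In a complete fan these are exactly the cones of dimension n. *)
Definition max_cones F : set (set 'rV[R]_n) :=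
  [set s | cones F s /\ forall t, cones F t -> s `<=` t -> t = s].

Definition refines F1 F :=
  support F1 = support F /\
  forall s1, cones F1 s1 -> exists2 s, cones F s & s1 `<=` s.

End Fans.

Definition image_cone {R : realType} {n n' : nat} (A : 'M[int]_(n, n'))
    (s : set 'rV[R]_n) : set 'rV[R]_n' := [set v *m extR A | v in s].

Definition maps_cones {R : realType} {n n' : nat} (A : 'M[int]_(n, n'))
    (F : fan R n) (F' : fan R n') :=
  forall s, cones F s -> exists2 s', cones F' s' & image_cone A s `<=` s'.

Section Charts.
Context {R : realType} {n : nat}.
Implicit Type s : set 'rV[R]_n.

(* The complex points of U_s = Spec C[S_s]: semigroup homomorphisms S_s -> C,
   extended by 0 outside S_s so that equal homomorphisms are equal functions. *)
Definition chart s : set ('cV[int]_n -> R[i]) :=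
  [set x | [/\ x 0 = 1,
     forall m m', dual_monoid s m -> dual_monoid s m' ->
       x (m + m') = x m * x m' &
     forall m, ~ dual_monoid s m -> x m = 0]].

(* Hom(M, C^* ), the chart of the zero cone *)
Definition torus : set ('cV[int]_n -> R[i]) := chart [set 0].

(* Elements of C[S_s], as finitely supported families of coefficients. *)
Definition semigroup_alg s : set ('cV[int]_n -> R[i]) :=
  [set f | finite_set [set m | f m != 0] /\
     forall m, f m != 0 -> dual_monoid s m].

Definition eval_alg (f x : 'cV[int]_n -> R[i]) : R[i] :=
  \sum_(m \in [set: 'cV[int]_n]) f m * x m.

(* chi^m *)
Definition character (m : 'cV[int]_n) (x : 'cV[int]_n -> R[i]) : R[i] := x m.

End Charts.

(* The homomorphism of tori induced by A, i.e. the rational map f_A restricted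
   to the torus; the same formula gives the toric morphisms on charts. *)
Definition torus_morphism {R : realType} {n n' : nat} (A : 'M[int]_(n, n'))
    (x : 'cV[int]_n -> R[i]) : 'cV[int]_n' -> R[i] :=
  fun m' => x (A *m m').

(* X(F) is glued from the charts U_s, the points x of U_s and y of U_t being
   identified when they are the restrictions of one point of U_(s `&` t).
   Every point therefore lies in a smallest chart, and is represented here by
   its coordinates there: [pt_minimal] says that x does not come from a smaller
   chart U_t, t a proper subcone of [pt_cone]. *)
Record toric_point {R : realType} {n : nat} (F : fan R n) := ToricPoint {
  pt_cone : set 'rV[R]_n;
  pt_val : 'cV[int]_n -> R[i];
  pt_cone_fan : cones F pt_cone;
  pt_chart : chart pt_cone pt_val;
  pt_minimal : forall t z, cones F t -> t `<=` pt_cone -> chart t z ->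
    (forall m, dual_monoid pt_cone m -> z m = pt_val m) -> t = pt_cone
}.

Section ToricVariety.
Context {R : realType} {n : nat} (F : fan R n).
Notation X := (toric_point F).

(* The open set U_s of X(F). The coordinates in U_s of a point of U_s are
   the restriction of [pt_val] to S_s. *)
Definition affine_open (s : set 'rV[R]_n) : set X := [set p | pt_cone p `<=` s].

Definition zariski_closed (Z : set X) :=
  forall s, cones F s ->
    exists2 I : set ('cV[int]_n -> R[i]), I `<=` semigroup_alg s &
      forall p, affine_open s p ->
        (Z p <-> forall f, I f -> eval_alg f (pt_val p) = 0).

Definition zariski_closure (Z : set X) : set X :=
  [set p | forall Y, zariski_closed Y -> Z `<=` Y -> Y p].

Definition zariski_open (U : set X) := zariski_closed (~` U).

Definition distinguished (s : set 'rV[R]_n) (m : 'cV[int]_n) : R[i] :=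
  (`[< perp s m >])%:R.

(* The orbit of the distinguished point of U_s under the torus Hom(M, C^* ),
   which acts by (t x)(m) = t(m) x(m). *)
Definition torus_orbit (s : set 'rV[R]_n) : set X :=
  [set p | pt_cone p = s /\ exists2 t, torus t &
     forall m, dual_monoid s m -> pt_val p m = t m * distinguished s m].

(* V(s) *)
Definition orbit_closure (s : set 'rV[R]_n) : set X :=
  zariski_closure (torus_orbit s).

(* Formal integral combinations of subvarieties, these being represented by
   their sets of points; Weil divisors are combinations of prime divisors. *)
Definition cycle := set X -> int.

Definition prime_cycle (V : set X) : cycle := fun Z => (`[< Z = V >])%:R.

(* sum over the rays s of F of c(s) V(s) *)
Definition toric_weil (c : set 'rV[R]_n -> int) : cycle :=
  fun Z => \sum_(s \in rays F) c s * prime_cycle (orbit_closure s) Z.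

End ToricVariety.

Arguments orbit_closure {R n} F s.
Arguments toric_weil {R n} F c.

(* Graph of the toric morphism X(F) -> X(F') induced by A when A maps cones of
   F into cones of F': if A maps s = [pt_cone x] into s', it sends x in U_s to
   the point of U_s' with coordinates m' |-> x(A *m m'), m' in S_s'. *)
Definition toric_morphism {R : realType} {n n' : nat} (A : 'M[int]_(n, n'))
    (F : fan R n) (F' : fan R n') (x : toric_point F) (y : toric_point F') :=
  exists s', [/\ cones F' s', image_cone A (pt_cone x) `<=` s',
    affine_open s' y &
    forall m', dual_monoid s' m' -> pt_val y m' = torus_morphism A (pt_val x) m'].

Section PushForward.
Context {R : realType} {n n' : nat} {F : fan R n} {F' : fan R n'}.
Context (f : toric_point F -> toric_point F' -> Prop).

Definition morph_image (V : set (toric_point F)) : set (toric_point F') :=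
  [set y | exists2 x, V x & f x y].

(* The degree of V over Z, the closure of its image: the number of points in a
   general fibre of V -> Z, and 0 if the general fibre is infinite. *)
Definition is_degree (V : set (toric_point F)) (Z : set (toric_point F'))
    (d : nat) :=
  exists U, [/\ zariski_open U, U `&` Z !=set0 &
    forall y, (U `&` Z) y -> ([set x | V x /\ f x y] #= `I_d)%card].

Definition degree V Z : nat := xget 0%N (is_degree V Z).

(* [V] is sent to deg(V / Z) [Z], where Z is the closure of the image of V. *)
Definition pushforward (W : cycle F) : cycle F' :=
  fun Z => \sum_(V \in [set V | zariski_closure (morph_image V) = Z])
             W V * (degree V Z)%:Z.

End PushForward.

(* Local equation chi^(- cartier_data s) on U_s, s a maximal cone; the values
   of [cartier_data] elsewhere are irrelevant. *)
Record cartier {R : realType} {n : nat} (F : fan R n) := Cartier {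
  cartier_data : set 'rV[R]_n -> 'cV[int]_n;
  cartier_compat : forall s t v, max_cones F s -> max_cones F t ->
    s v -> t v ->
    pairing (extR (cartier_data s)) v = pairing (extR (cartier_data t)) v
}.

(* psi_D; by compatibility the choice of the maximal cone is irrelevant. *)
Definition support_function {R : realType} {n : nat} {F : fan R n}
    (D : cartier F) (v : 'rV[R]_n) : R :=
  let s := xget set0 [set s | max_cones F s /\ s v] in
  pairing (extR (cartier_data D s)) v.

(* psi_D on the lattice, where its values are integers: [floor] is a cast. *)
Definition support_function_lattice {R : realType} {n : nat} {F : fan R n}
    (D : cartier F) (v : 'rV[int]_n) : int :=
  Num.floor (support_function D (extR v)).

Definition weil_of_cartier {R : realType} {n : nat} {F : fan R n}
    (D : cartier F) : cycle F :=
  toric_weil F (fun s => - support_function_lattice D (ray_generator s)).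

(* E is the pull back of D by the toric morphism induced by A: whenever A maps
   s into s', the local equation of E on U_s is, up to a unit g of C[S_s] with
   inverse h, the local equation of D on U_s' composed with the morphism.
   Rational functions are compared on the torus. *)
Definition cartier_pullback {R : realType} {n n' : nat} {F : fan R n}
    {F' : fan R n'} (A : 'M[int]_(n, n')) (D : cartier F') (E : cartier F) :=
  forall s s', max_cones F s -> max_cones F' s' -> image_cone A s `<=` s' ->
  exists g h : 'cV[int]_n -> R[i],
    [/\ semigroup_alg s g, semigroup_alg s h &
     forall t, torus t ->
       eval_alg g t * eval_alg h t = 1 /\
       character (- cartier_data E s) t =
         eval_alg g t * character (- cartier_data D s') (torus_morphism A t)].

(* Main.v *)
Require Import Defs.
From HB Require Import structures.
From mathcomp Require Import all_boot all_order all_algebra.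
From mathcomp Require Import boolp classical_sets functions cardinality fsbigop.
From mathcomp Require Import reals complex.
From mathcomp Require Import ring lra zify.

Set Implicit Arguments.
Unset Strict Implicit.
Unset Printing Implicit Defensive.

Import Order.TTheory GRing.Theory Num.Theory.
Local Open Scope classical_set_scope.
Local Open Scope ring_scope.

(** The proof computes the push-forward of the pulled-back divisor ray by ray.

    Orbit closures become combinatorial: V(s) is the set of points whose
    smallest chart cone contains s ([orbit_closureE]). One inclusion is that
    this set is closed. For the other, an element of C[S_t] that vanishes on
    the orbit of s has no coefficient on the monomials of the annihilator of s,
    by linear independence of characters of the torus ([vanish_on_orbit]); at a
    point whose cone contains s, all the other monomials vanish, so the element
    vanishes there as well. All this depends on a dictionary between
    vanishing of coordinates and faces: the coordinate m is nonzero at a point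
    exactly when m annihilates the cone of that point ([pt_val_nz]). It is
    available because faces, although cut out by real functionals, can be
    cut out by integral ones ([rational_face]), and passing to a face then only
    inverts one monomial ([localization], [chart_extend]).

    Let V be the divisor of a ray s of the refinement. If s is a ray of Sigma,
    the birational morphism is bijective over the orbit of s, so V maps to the
    divisor of s with degree 1 ([image_orbit_closure], [degree_common]). If s is
    not in Sigma, some one-parameter subgroup acts without fixed points on the
    orbit of s but trivially on its image, so fibres are infinite and V
    contributes degree 0 ([new_ray_direction], [degree_new]). Since every
    ray of Sigma is a ray of the refinement ([ray_in_refinement]), exactly the
    rays of Sigma survive, with the coefficients of the pulled-back divisor E.

    These coefficients are found by comparing local equations: a unit of C[S_s]
    which is a monomial on the torus has exponent in the annihilator of s
    ([unit_monomial]), hence the support function of E is that of D composed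
    with A ([support_function_pullback]). *)

(** * Pairing between the lattices *)

Section Pairing.
Context {R : realType} {n : nat}.
Implicit Types (u : 'cV[R]_n) (v : 'rV[R]_n) (m : 'cV[int]_n).

Lemma pairingDl u1 u2 v : pairing (u1 + u2) v = pairing u1 v + pairing u2 v.
Proof. by rewrite /pairing mulmxDr mxE. Qed.

Lemma pairingZr u a v : pairing u (a *: v) = a * pairing u v.
Proof. by rewrite /pairing -scalemxAl mxE. Qed.

Lemma pairingNl u v : pairing (- u) v = - pairing u v.
Proof. by rewrite /pairing mulmxN mxE. Qed.

Lemma pairing0l v : pairing 0 v = 0.
Proof. by rewrite /pairing mulmx0 mxE. Qed.

Lemma pairingMnl u k v : pairing (u *+ k) v = k%:R * pairing u v.
Proof.
elim: k => [|k IH]; first by rewrite mulr0n pairing0l mul0r.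
by rewrite mulrS pairingDl IH -natr1 mulrDl mul1r addrC.
Qed.

Lemma pairing_mul n' (B : 'M[R]_(n, n')) (u : 'cV[R]_n') v :
  pairing u (v *m B) = pairing (B *m u) v.
Proof. by rewrite /pairing mulmxA. Qed.

Lemma pairing_comb k (c : 'rV[R]_k) (M : 'M[R]_(k, n)) u :
  pairing u (c *m M) = \sum_i c 0 i * pairing u (row i M).
Proof.
rewrite /pairing -mulmxA mxE; apply: eq_bigr => i _.
by rewrite -row_mul [in RHS]mxE.
Qed.

Lemma extR_mul p q r (B : 'M[int]_(p, q)) (C : 'M[int]_(q, r)) :
  extR (B *m C) = extR B *m extR C :> 'M[R]_(p, r).
Proof. exact: map_mxM. Qed.

Lemma extRD p q (B C : 'M[int]_(p, q)) :
  extR (B + C) = extR B + extR C :> 'M[R]_(p, q).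
Proof. exact: map_mxD. Qed.

Lemma extRN p q (B : 'M[int]_(p, q)) : extR (- B) = - extR B :> 'M[R]_(p, q).
Proof. exact: map_mxN. Qed.

Lemma extR0 p q : extR 0 = 0 :> 'M[R]_(p, q).
Proof. exact: map_mx0. Qed.

Lemma extRMn p q (B : 'M[int]_(p, q)) k :
  extR (B *+ k) = extR B *+ k :> 'M[R]_(p, q).
Proof. by apply/matrixP => i j; rewrite !mxE !mulmxnE !mxE rmorphMn. Qed.

Lemma pairing_int m (v : 'rV[int]_n) :
  pairing (extR m) (extR v) = ((v *m m) 0 0)%:~R :> R.
Proof. by rewrite /pairing -extR_mul mxE. Qed.

Lemma row_extR k (G : 'M[int]_(k, n)) i :
  row i (extR G : 'M[R]_(k, n)) = extR (row i G).
Proof. by rewrite /extR map_row. Qed.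

End Pairing.

(** * Rational faces *)

Section RationalFaces.
Context {R : realType}.

Lemma clear_denominators p q (K : 'M[rat]_(p, q)) :
  exists d : int, 0 < d /\
    exists L : 'M[int]_(p, q), map_mx intr L = d%:~R *: K.
Proof.
exists (\prod_(x : 'I_p * 'I_q) denq (K x.1 x.2)); split.
  by apply: prodr_gt0 => x _.
exists (\matrix_(i, j)
  (numq (K i j) * \prod_(x | x != (i, j)) denq (K x.1 x.2))).
apply/matrixP => i j; rewrite !mxE [in RHS](bigD1 (i, j)) //= !intrM.
rewrite mulrAC; congr (_ * _).
by rewrite numqE mulrC.
Qed.

(** Replace c by the integral part of N c: this changes each entry of H (N c) by
    at most the l1-norm S i of the row, which is negligible against the growth
    of N (H c) i as N increases. *)
Lemma integer_positive_combination k p (H : 'M[int]_(k, p)) (c : 'cV[R]_p) :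
  exists z : 'cV[int]_p, forall i,
    0 < (extR H *m c) i 0 -> 0 < (H *m z) i 0.
Proof.
pose S i : R := \sum_j `|(H i j)%:~R|.
have S0 i : 0 <= S i by apply: sumr_ge0.
pose a i := (extR H *m c) i 0.
pose N : nat := \sum_i Num.truncn (S i / a i + 1).
have NP i : 0 < a i -> S i < N.+1%:R * a i.
  move=> ai; rewrite -ltr_pdivrMr //.
  apply: (lt_le_trans (truncnS_gt _)); rewrite ler_nat ltnS /N.
  rewrite (bigD1 i) //=; apply: leq_trans (leq_addr _ _).
  by apply: le_truncn; lra.
exists (\col_j Num.floor (N.+1%:R * c j 0)) => i ai.
rewrite -(ltr_int R).
have -> : (((H *m (\col_j Num.floor (N.+1%:R * c j 0))) i 0)%:~R : R) =
    N.+1%:R * a i - \sum_j (H i j)%:~R *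
      (N.+1%:R * c j 0 - (Num.floor (N.+1%:R * c j 0))%:~R).
  rewrite /a !mxE rmorph_sum mulr_sumr -sumrB; apply: eq_bigr => j _.
  by rewrite !mxE rmorphM /=; ring.
rewrite subr_gt0; apply: le_lt_trans (NP i ai).
apply: ler_sum => j _; set x := _ * c j 0.
have := Num.Theory.floor_le x; have := floorD1_gt x; rewrite intrD => xl xg.
apply: le_trans (ler_norm _) _; rewrite normrM ler_piMr //.
by rewrite ger0_norm; lra.
Qed.

(** The functionals vanishing on the rows where u vanishes form a space defined
    over the rationals, so u is a real combination of integral functionals of
    that space; rounding a large multiple of the coefficients keeps the finitely
    many strict inequalities. *)
Lemma integer_supporting_functional k n (G : 'M[int]_(k, n)) (u : 'cV[R]_n) :
  exists m : 'cV[int]_n, forall i,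
    ((extR G *m u) i 0 = 0 -> (G *m m) i 0 = 0) /\
    (0 < (extR G *m u) i 0 -> 0 < (G *m m) i 0).
Proof.
move wE: (extR G *m u) => w.
(* Zero rows impose no condition: the kernel is that of the rows killed by u. *)
pose GP : 'M[rat]_(k, n) :=
  \matrix_(i, j) if w i 0 == 0 then (G i j)%:~R else 0.
have GPu : u^T *m (map_mx ratr GP)^T = 0.
  rewrite -trmx_mul; apply/matrixP => j i; rewrite !mxE.
  have [Gi|Gi] := eqVneq (w i 0) 0; last first.
    by apply: big1 => l _; rewrite !mxE (negbTE Gi) rmorph0 mul0r.
  rewrite -[RHS]Gi -wE [RHS]mxE; apply: eq_bigr => l _.
  by rewrite !mxE Gi eqxx ratr_int (ord1 j).
have [d [d0 [L LE]]] := clear_denominators (kermx GP^T).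
have /submxP [c uE] : (u^T <= map_mx (@ratr R) (kermx GP^T))%MS.
  by rewrite map_kermx -map_trmx; apply/sub_kermxP.
have LR : (extR L : 'M[R]_n) = d%:~R *: map_mx ratr (kermx GP^T).
  have -> : (d%:~R : R) = ratr d%:~R by rewrite ratr_int.
  rewrite -map_mxZ -LE.
  by apply/matrixP => i j; rewrite !mxE /= ratr_int.
have uL : u = (extR L)^T *m (d%:~R^-1 *: c^T).
  rewrite -[u]trmxK uE LR trmx_mul [(_ *: _)^T]linearZ /=.
  rewrite -scalemxAl -scalemxAr scalerA.
  by rewrite mulfV ?scale1r // intr_eq0 gt_eqF.
have [z zP] := integer_positive_combination (G *m L^T) (d%:~R^-1 *: c^T).
exists (L^T *m z) => i; rewrite mulmxA; split; last first.
  move=> Gi; apply: zP; rewrite extR_mul -mulmxA.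
  by rewrite {2}/extR -map_trmx -uL wE.
move=> Gi; rewrite mxE; apply: big1 => j _.
suff -> : (G *m L^T) i j = 0 by rewrite mul0r.
apply/eqP; rewrite -(intr_eq0 rat) mxE rmorph_sum /=; apply/eqP.
have := mulmx_ker GP^T => /matrixP/(_ j i)/(congr1 (fun x => d%:~R * x)).
rewrite !mxE mulr0 mulr_sumr => kE; rewrite -[RHS]kE; apply: eq_bigr => l _.
rewrite rmorphM /= mulrC mulrA; congr (_ * _); last first.
  by rewrite !mxE Gi eqxx.
by have /matrixP/(_ j l) := LE; rewrite !mxE.
Qed.

End RationalFaces.

(** * Faces and dual monoids *)

Section Cones.
Context {R : realType} {n : nat}.
Implicit Types (s t : set 'rV[R]_n) (m : 'cV[int]_n).

Lemma cone_genZ k (G : 'M[int]_(k, n)) a v :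
  0 <= a -> cone_gen G v -> cone_gen G (a *: v : 'rV[R]_n).
Proof.
move=> a0 [c [c0 ->]]; exists (a *: c); split; last by rewrite scalemxAl.
by move=> i; rewrite mxE mulr_ge0.
Qed.

Lemma cone_gen_row k (G : 'M[int]_(k, n)) i :
  cone_gen G (extR (row i G) : 'rV[R]_n).
Proof.
exists (delta_mx 0 i); split; last by rewrite -rowE row_extR.
by move=> j; rewrite mxE ler0n.
Qed.

Lemma is_coneZ s a v : is_cone s -> 0 <= a -> s v -> s (a *: v).
Proof. by move=> [[k [G ->]] _]; exact: cone_genZ. Qed.

Lemma is_cone0 s : is_cone s -> s 0.
Proof.
move=> [[k [G ->]] _]; exists 0; split; last by rewrite mul0mx.
by move=> i; rewrite mxE.
Qed.

Lemma pairing_cone_gen k (G : 'M[int]_(k, n)) (u : 'cV[R]_n) c :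
  pairing u (c *m extR G) = \sum_i c 0 i * pairing u (extR (row i G)).
Proof. by rewrite pairing_comb; apply: eq_bigr => i _; rewrite row_extR. Qed.

(** Faces are cut out by real functionals, whereas coordinates on charts are
    integral; this lemma makes every face accessible to a single coordinate. *)
Lemma rational_face s t : is_cone s -> is_face t s ->
  exists2 m, dual_monoid s m & t = s `&` [set v | pairing (extR m) v = 0].
Proof.
move=> [[k [G ->]] _] [u [u0 ->]].
have [m mP] := integer_supporting_functional G u.
have uG i : (extR G *m u) i 0 = pairing u (extR (row i G)).
  by rewrite /pairing -row_extR -row_mul [in RHS]mxE.
have mG i : pairing (extR m) (extR (row i G)) = ((G *m m) i 0)%:~R :> R.
  by rewrite pairing_int -row_mul [in LHS]mxE.
have u0G i : 0 <= (extR G *m u) i 0.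
  by rewrite uG; apply/u0/cone_gen_row.
have m0G i : 0 <= pairing (extR m) (extR (row i G)) :> R.
  rewrite mG ler0z; have := u0G i; rewrite le_eqVlt => /orP[/eqP ui|ui].
    by rewrite (proj1 (mP i)).
  by apply/ltW/(proj2 (mP i)).
exists m.
  move=> v [c [c0 ->]]; rewrite pairing_cone_gen.
  by apply: sumr_ge0 => i _; apply: mulr_ge0.
apply/seteqP; split => v [] [c [c0 ->]] /=; rewrite pairing_cone_gen => /eqP uv;
  (split; first by exists c); rewrite pairing_cone_gen; apply: big1 => i _;
  move: uv; rewrite psumr_eq0;
  try by (move=> j _; apply: mulr_ge0 => //; rewrite -uG).
  move=> /allP/(_ i (mem_index_enum _)) /=; rewrite mulf_eq0.
  move=> /orP[/eqP->|]; first by rewrite mul0r.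
  by rewrite -uG => /eqP /(proj1 (mP i)) ui; rewrite mG ui mulr0.
move=> /allP/(_ i (mem_index_enum _)) /=; rewrite mulf_eq0.
move=> /orP[/eqP->|]; first by rewrite mul0r.
rewrite mG intr_eq0 => /eqP mi; have := u0G i; rewrite le_eqVlt.
move=> /orP[/eqP ui|/(proj2 (mP i))]; last by rewrite mi ltxx.
by rewrite -uG -ui mulr0.
Qed.

Lemma face_of_functional s m : dual_monoid s m ->
  is_face (s `&` [set v | pairing (extR m) v = 0]) s.
Proof. by move=> sm; exists (extR m). Qed.

Lemma dual_monoidD s m m' :
  dual_monoid s m -> dual_monoid s m' -> dual_monoid s (m + m').
Proof.
by move=> sm sm' v sv; rewrite extRD pairingDl addr_ge0 ?sm ?sm'.
Qed.

Lemma dual_monoidMn s m k : dual_monoid s m -> dual_monoid s (m *+ k).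
Proof.
by move=> sm v sv; rewrite extRMn pairingMnl mulr_ge0 ?ler0n ?sm.
Qed.

Lemma dual_monoid0 s : dual_monoid s 0.
Proof. by move=> v sv; rewrite extR0 pairing0l. Qed.

Lemma dual_monoidS s t m : t `<=` s -> dual_monoid s m -> dual_monoid t m.
Proof. by move=> ts sm v /ts; apply: sm. Qed.

Lemma perp_dual s m : perp s m -> dual_monoid s m.
Proof. by move=> sm v /sm ->. Qed.

Lemma perpN s m : perp s m -> perp s (- m).
Proof. by move=> sm v /sm; rewrite extRN pairingNl => ->; rewrite oppr0. Qed.

Lemma perp0 s : perp s 0.
Proof. by move=> v _; rewrite extR0 pairing0l. Qed.

Lemma perpS s t m : t `<=` s -> perp s m -> perp t m.
Proof. by move=> ts sm v /ts; apply: sm. Qed.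

Lemma perpD s m m' : dual_monoid s m -> dual_monoid s m' ->
  perp s (m + m') <-> perp s m /\ perp s m'.
Proof.
move=> sm sm'; split=> [mm'|[pm pm'] v sv]; last first.
  by rewrite extRD pairingDl pm ?pm' ?addr0.
have mm'v v : s v -> pairing (extR m) v = 0 /\ pairing (extR m') v = 0.
  move=> sv; have := mm' v sv; rewrite extRD pairingDl => /eqP.
  rewrite paddr_eq0 ?sm ?sm' //.
  by move=> /andP[/eqP ? /eqP ?].
by split=> v /mm'v [].
Qed.

Lemma perp_dualN s m : dual_monoid s m -> dual_monoid s (- m) -> perp s m.
Proof.
move=> sm sNm; apply: (proj1 (proj1 (perpD sm sNm) _)).
by rewrite subrr; exact: perp0.
Qed.

(** S_t is obtained from S_s by inverting m0: on the generators of s outside t,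
    m0 takes positive integral values, hence a large multiple of it compensates
    the negative values of m. *)
Lemma localization s t m0 m : is_cone s -> dual_monoid s m0 ->
  t = s `&` [set v | pairing (extR m0) v = 0] -> dual_monoid t m ->
  exists k, dual_monoid s (m + m0 *+ k).
Proof.
move=> [[k [G ->]] _] sm0 -> tm.
pose a i : int := (row i G *m m) 0 0.
exists (\sum_i `|a i|)%N => v [c [c0 ->]].
rewrite pairing_cone_gen; apply: sumr_ge0 => i _; apply: mulr_ge0 => //.
rewrite extRD pairingDl extRMn pairingMnl.
have := sm0 _ (cone_gen_row G i); rewrite le_eqVlt => /orP[/eqP m0i|].
  rewrite -m0i mulr0 addr0; apply: tm; split=> //; exact: cone_gen_row.
rewrite !pairing_int ltr0z => m0i.
rewrite -[_%:R]mulrz_nat -intrM -intrD ler0z.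
rewrite (bigD1 i) //=.
rewrite -/(a i); set b := (row i G *m m0) 0 0 in m0i *.
have : 0 <= a i + `|a i|%:Z * b by nia.
move=> h; apply: le_trans h _; rewrite lerD2l ler_wpM2r ?(ltW m0i) //.
by rewrite natz lez_nat leq_addr.
Qed.

End Cones.

(** * Points of charts and of toric varieties *)

Section ChartPoints.
Context {R : realType} {n : nat}.
Implicit Types (s t : set 'rV[R]_n) (m : 'cV[int]_n).
Implicit Types (x y z : 'cV[int]_n -> R[i]).

Lemma chart0 s x : chart s x -> x 0 = 1.
Proof. by case. Qed.

Lemma chartD s x m m' : chart s x -> dual_monoid s m -> dual_monoid s m' ->
  x (m + m') = x m * x m'.
Proof. by case=> _ xD _; apply: xD. Qed.

Lemma chartMn s x m k : chart s x -> dual_monoid s m -> x (m *+ k) = x m ^+ k.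
Proof.
move=> sx sm; elim: k => [|k IH]; first by rewrite mulr0n expr0 (chart0 sx).
by rewrite mulrS exprS (chartD sx) // ?IH //; apply: dual_monoidMn.
Qed.

Lemma chart_nz_dual s x m : chart s x -> x m != 0 -> dual_monoid s m.
Proof.
by case=> _ _ x0; apply: contra_neqP => /x0.
Qed.

Lemma chart_perp_nz s x m : chart s x -> perp s m -> x m != 0.
Proof.
move=> sx pm; have := chartD sx (perp_dual pm) (perp_dual (perpN pm)).
rewrite subrr (chart0 sx) => h; apply/eqP => xm.
by move/eqP: h; rewrite xm mul0r oner_eq0.
Qed.

(** Separatedness: U_t is a principal open subset of U_s, so a point of U_t is
    known once its coordinates in U_s are. *)
Lemma chart_eq_face s t x z : is_cone s -> is_face t s ->
  chart t x -> chart t z -> (forall m, dual_monoid s m -> x m = z m) -> x = z.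
Proof.
move=> cs fts tx tz xz; have [m0 sm0 tE] := rational_face cs fts.
have ts : t `<=` s by rewrite tE; apply: subIsetl.
have pm0 : perp t m0 by move=> v; rewrite tE => -[].
apply: funext => m; have [tm|tm] := pselect (dual_monoid t m); last first.
  by case: tx => _ _ ->//; case: tz => _ _ ->.
have [k sk] := localization cs sm0 tE tm.
have tm0 := perp_dual pm0.
apply: (mulIf (expf_neq0 k (chart_perp_nz tx pm0))).
have tkm0 := dual_monoidMn k tm0.
rewrite [in RHS](xz _ sm0) -(chartMn k tx) // -(chartMn k tz) //.
by rewrite -(chartD tx) // -(chartD tz) // xz.
Qed.

(** A point of U_s outside the divisor of the monomial m0 lies in the principal
    open subset attached to the face cut out by m0: its new coordinates are
    the fractions x (m + k m0) / x(m0)^k. *)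
Lemma chart_extend s x m0 : is_cone s -> chart s x -> dual_monoid s m0 ->
  x m0 != 0 ->
  exists2 z, chart (s `&` [set v | pairing (extR m0) v = 0]) z &
    forall m, dual_monoid s m -> z m = x m.
Proof.
move=> cs sx sm0 xm0; set t := s `&` _.
have ts : t `<=` s by apply: subIsetl.
pose K m := xget 0%N [set k | dual_monoid s (m + m0 *+ k)].
have KP m : dual_monoid t m -> dual_monoid s (m + m0 *+ K m).
  by move=> tm; apply: xgetPex (localization cs sm0 erefl tm).
pose w m k := x (m + m0 *+ k) / x m0 ^+ k.
have w_indep m k k' : dual_monoid s (m + m0 *+ k) ->
    dual_monoid s (m + m0 *+ k') -> w m k = w m k'.
  move=> sk sk'; apply/eqP; rewrite /w eqr_div ?expf_neq0 //; apply/eqP.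
  rewrite -!(chartMn _ sx sm0) -!(chartD sx) //; try exact: dual_monoidMn.
  by congr x; rewrite -!addrA; congr (_ + _); rewrite addrC.
exists (fun m => if `[< dual_monoid t m >] then w m (K m) else 0); last first.
  move=> m sm; rewrite asboolT; last exact: dual_monoidS sm.
  rewrite (w_indep _ _ 0%N) ?mulr0n ?addr0 //.
    by rewrite /w mulr0n addr0 expr0 divr1.
  by apply: KP; apply: dual_monoidS sm.
split=> [|m m' tm tm'|m tm]; last by rewrite asboolF.
- rewrite asboolT; last exact: dual_monoid0.
  rewrite (w_indep _ _ 0%N) ?mulr0n ?addr0; try exact: dual_monoid0.
    by rewrite /w mulr0n addr0 expr0 divr1 (chart0 sx).
  by apply: KP; apply: dual_monoid0.
rewrite !asboolT //; last exact: dual_monoidD.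
have E : m + m' + m0 *+ (K m + K m') = (m + m0 *+ K m) + (m' + m0 *+ K m').
  by rewrite mulrnDr addrACA.
rewrite (w_indep _ _ (K m + K m')%N); first last.
- by rewrite E; apply: dual_monoidD; apply: KP.
- by apply/KP/dual_monoidD.
rewrite /w E (chartD sx); try exact: KP.
rewrite exprD invfM.
by rewrite mulrACA.
Qed.

End ChartPoints.

Lemma finite_minimal (T : choiceType) (r : T -> T -> Prop) (A : set T) :
  (forall a b c, r a b -> r b c -> r a c) ->
  (forall a b, r a b -> r b a -> a = b) ->
  finite_set A -> A !=set0 ->
  exists2 a, A a & forall b, A b -> r b a -> b = a.
Proof.
move=> rT rA /finite_seqP [l ->]; elim: l => [[] //|a l IH _].
have [ln0|l0] := pselect ([set` l] !=set0); last first.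
  exists a => [|b]; rewrite /= inE ?eqxx // => /orP[/eqP //|bl].
  by case: l0; exists b.
have [b bl bmin] := IH ln0.
have [ab|ab] := pselect (r a b).
  exists a => [|c]; rewrite /= inE ?eqxx // => /orP[/eqP //|cl ca].
  have cb := bmin _ cl (rT _ _ _ ca ab).
  by apply: rA => //; rewrite cb.
exists b => [|c]; rewrite /= inE ?bl ?orbT // => /orP[/eqP->//|].
exact: bmin.
Qed.

Section Fans.
Context {R : realType} {n : nat} (F : fan R n).
Implicit Types (s t : set 'rV[R]_n) (m : 'cV[int]_n) (x y : toric_point F).

Lemma fan_minimal (P : set (set 'rV[R]_n)) : P `<=` cones F -> P !=set0 ->
  exists2 t, P t & forall t', P t' -> t' `<=` t -> t' = t.
Proof.
move=> PF; apply: finite_minimal; last exact: sub_finite_set PF (fan_finite F).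
  by move=> a b c; apply: subset_trans.
by move=> a b ab ba; apply/seteqP.
Qed.

Lemma sub_max_cone s : cones F s -> exists2 t, max_cones F t & s `<=` t.
Proof.
move=> Fs; have [||||t [Ft st] tmax] := @finite_minimal _ (fun a b => b `<=` a)
  [set t | cones F t /\ s `<=` t].
- by move=> a b c ba cb; apply: subset_trans ba.
- by move=> a b ab ba; apply/seteqP.
- by apply: sub_finite_set (fan_finite F) => t [].
- by exists s; split.
exists t => //; split=> // t' Ft' tt'; apply: tmax => //.
by split=> //; apply: subset_trans tt'.
Qed.

Lemma fan_sub_face s t : cones F s -> cones F t -> t `<=` s -> is_face t s.
Proof.
move=> Fs Ft ts; have := fan_meet Fs Ft.
by rewrite setIC (setIidl ts).
Qed.

Lemma fan_functional_face s m : cones F s -> dual_monoid s m ->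
  cones F (s `&` [set v | pairing (extR m) v = 0]).
Proof. by move=> Fs sm; apply: fan_face Fs _; apply: face_of_functional. Qed.

Lemma fan_rational_face s t : cones F s -> cones F t -> t `<=` s ->
  exists2 m, dual_monoid s m & t = s `&` [set v | pairing (extR m) v = 0].
Proof.
by move=> Fs Ft ts; apply: rational_face (fan_cone Fs) (fan_sub_face Fs Ft ts).
Qed.

(** Were x m nonzero for some m not in the annihilator, the point would already
    come from the proper face cut out by m. *)
Lemma pt_val_nz x m : pt_val x m != 0 <-> perp (pt_cone x) m.
Proof.
split=> [xm|]; last exact: chart_perp_nz (pt_chart x).
have Fp := pt_cone_fan x; have pm := chart_nz_dual (pt_chart x) xm.
have [z tz zE] := chart_extend (fan_cone Fp) (pt_chart x) pm xm.
have <- : pt_cone x `&` [set v | pairing (extR m) v = 0] = pt_cone x.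
  by apply: pt_minimal tz zE; [exact: fan_functional_face | exact: subIsetl].
by move=> v [].
Qed.

Lemma pt_val_eq0 x m : ~ perp (pt_cone x) m -> pt_val x m = 0.
Proof. by move=> pm; apply: contra_notP pm => /eqP /pt_val_nz. Qed.

Lemma toric_point_ext x y :
  pt_cone x = pt_cone y -> pt_val x = pt_val y -> x = y.
Proof.
case: x y => [s u Fs su smin] [s' u' Fs' su' smin'] /= es eu.
subst s' u'; congr ToricPoint; exact: Prop_irrelevance.
Qed.

(** Among the charts from which z comes, take one with a minimal cone. *)
Lemma chart_point s z : cones F s -> chart s z ->
  exists2 x : toric_point F, pt_cone x `<=` s &
    forall m, dual_monoid s m -> pt_val x m = z m.
Proof.
move=> Fs sz.
have [||t [Ft ts [u tu uz]] tmin] := @fan_minimal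
  [set t | [/\ cones F t, t `<=` s & exists2 u, chart t u &
    forall m, dual_monoid s m -> u m = z m]].
- by move=> t [].
- by exists s; split=> //; exists z.
suff H : forall t' w, cones F t' -> t' `<=` t -> chart t' w ->
    (forall m, dual_monoid t m -> w m = u m) -> t' = t.
  by exists (ToricPoint Ft tu H).
move=> t' w Ft' tt' tw wu; apply: tmin => //; split=> //.
  exact: subset_trans ts.
by exists w => // m sm; rewrite wu ?uz //; apply: dual_monoidS sm.
Qed.

Lemma chart_orbit_point s z : cones F s -> chart s z ->
  (forall m, z m != 0 -> perp s m) ->
  exists2 x : toric_point F, pt_cone x = s & pt_val x = z.
Proof.
move=> Fs sz zP.
suff H : forall t w, cones F t -> t `<=` s -> chart t w ->
    (forall m, dual_monoid s m -> w m = z m) -> t = s.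
  by exists (ToricPoint Fs sz H).
move=> t w Ft ts tw wz; have [m sm tE] := fan_rational_face Fs Ft ts.
apply/seteqP; split=> // v sv; rewrite tE; split=> //.
apply: (zP m) => //; rewrite -wz //; apply: chart_perp_nz tw _.
by move=> v'; rewrite tE => -[].
Qed.

End Fans.

(** * Linear independence of characters *)

Section Characters.
Context {R : realType} {n : nat}.
Implicit Types (m : 'cV[int]_n) (w : 'rV[int]_n) (t : 'cV[int]_n -> R[i]).

(** The value at 2 of the one-parameter subgroup of w. As 2 is not a root of
    unity, its powers can tell all characters apart. *)
Definition one_param w m : R[i] := 2 ^ ((w *m m) 0 0).

Lemma expz2_inj : injective (exprz (2 : R[i])).
Proof.
have -> : (2 : R[i]) = ratr 2 by rewrite rmorph_nat.
move=> a b; rewrite -!fmorphXz => /fmorph_inj.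
by apply: ieexprIz.
Qed.

Lemma dual_monoid_zero m : dual_monoid ([set 0] : set 'rV[R]_n) m.
Proof. by move=> v /= ->; rewrite /pairing mul0mx mxE. Qed.

Lemma torusP t :
  torus t <-> t 0 = 1 /\ forall m m', t (m + m') = t m * t m'.
Proof.
split=> [[t0 tD _]|[t0 tD]].
  by split=> // m m'; apply: tD; apply: dual_monoid_zero.
by split=> // m []; apply: dual_monoid_zero.
Qed.

Lemma torusM t t' : torus t -> torus t' -> torus (fun m => t m * t' m).
Proof.
move=> /torusP[t0 tD] /torusP[t0' tD']; apply/torusP; split.
  by rewrite t0 t0' mulr1.
by move=> m m'; rewrite tD tD' mulrACA.
Qed.

Lemma torus_nz t m : torus t -> t m != 0.
Proof.
move=> tt; apply: chart_perp_nz tt _ => v /= ->.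
by rewrite /pairing mul0mx mxE.
Qed.

Lemma torus_one_param w : torus (one_param w).
Proof.
apply/torusP; split; first by rewrite /one_param mulmx0 mxE expr0z.
by move=> m m'; rewrite /one_param mulmxDr mxE expfzDr // pnatr_eq0.
Qed.

Lemma torus_separates m m' : m != m' ->
  exists2 t, torus t & (t : _ -> R[i]) m != t m'.
Proof.
move=> mm'; have [j mj] : exists j, m j 0 != m' j 0.
  apply: contrapT => nj; case/eqP: mm'; apply/matrixP => j k.
  by rewrite (ord1 k); apply: contrapT => /eqP mj; apply: nj; exists j.
exists (one_param (delta_mx 0 j)); first exact: torus_one_param.
rewrite /one_param -!rowE !mxE.
by apply: contra_neq mj; apply: expz2_inj.
Qed.

(** Dedekind's argument: subtracting t0(m0) times the relation from its
    translate by t0 cancels the term of m0, and for each other m some t0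
    separates m from m0. *)
Lemma character_independence (ms : seq 'cV[int]_n) (a : 'cV[int]_n -> R[i]) :
  uniq ms -> (forall t, torus t -> \sum_(m <- ms) a m * t m = 0) ->
  forall m, m \in ms -> a m = 0.
Proof.
elim: ms a => [//|m0 ms IH] a /= /andP[m0ms ums] a0.
have ams m : m \in ms -> a m = 0.
  move=> mms; have [|t0 tt0 tm] := @torus_separates m m0.
    by apply: contraNneq m0ms => <-.
  have /(_ _ m mms) := IH (fun m => a m * (t0 m - t0 m0)) ums.
  move=> /(_ _)/eqP; rewrite mulf_eq0 subr_eq0 (negbTE tm) orbF => h.
  apply/eqP/h => t tt.
  transitivity (\sum_(l <- m0 :: ms) a l * (t0 l - t0 m0) * t l).
    by rewrite big_cons subrr mulr0 mul0r add0r.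
  transitivity (\sum_(l <- m0 :: ms) a l * (t0 l * t l) -
      t0 m0 * \sum_(l <- m0 :: ms) a l * t l).
    by rewrite mulr_sumr -sumrB; apply: eq_bigr => l _; ring.
  by have /= -> := a0 _ (torusM tt0 tt); rewrite a0 // mulr0 subr0.
move=> m; rewrite inE => /orP[/eqP->|/ams //].
have tt := torus_one_param 0.
have := a0 _ tt; rewrite big_cons big1_seq ?addr0; last first.
  by move=> l /= /ams ->; rewrite mul0r.
by move=> /eqP; rewrite mulf_eq0 (negbTE (torus_nz _ tt)) orbF => /eqP.
Qed.

Lemma eval_algE (f x : 'cV[int]_n -> R[i]) (ms : seq 'cV[int]_n) :
  uniq ms -> (forall m, f m != 0 -> m \in ms) ->
  eval_alg f x = \sum_(m <- ms) f m * x m.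
Proof.
move=> ums fms; rewrite /eval_alg (fsbigE ms) //.
  by apply: eq_bigl => m; rewrite in_setT.
by move=> m _; apply: contraNeq; rewrite mulf_eq0 negb_or => /andP[/fms].
Qed.

Definition fin_supp (f : 'cV[int]_n -> R[i]) := finite_set [set m | f m != 0].

Lemma fin_supp_seq (f : 'cV[int]_n -> R[i]) : fin_supp f ->
  exists2 ms, uniq ms & forall m, f m != 0 -> m \in ms.
Proof.
move=> /finite_seqP [l /seteqP[fl _]]; exists (undup l); first exact: undup_uniq.
by move=> m fm; rewrite mem_undup; exact: fl.
Qed.

Lemma eval_alg_monomial (f : 'cV[int]_n -> R[i]) m0 : fin_supp f ->
  (forall t, torus t -> eval_alg f t = t m0) -> f m0 = 1.
Proof.
move=> /fin_supp_seq [ms ums fms] fE.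
pose ms' := undup (m0 :: ms); have ums' : uniq ms' by apply: undup_uniq.
have m0ms' : m0 \in ms' by rewrite mem_undup inE eqxx.
apply/eqP; rewrite -subr_eq0; apply/eqP.
have := @character_independence ms' (fun m => f m - (m == m0)%:R)
  ums' _ m0 m0ms'.
rewrite eqxx; apply=> t tt.
under eq_bigr do rewrite mulrBl; rewrite sumrB -eval_algE //; last first.
  by move=> m /fms mms; rewrite mem_undup inE mms orbT.
rewrite fE // (bigD1_seq m0) //= eqxx mul1r big1 ?addr0 ?subrr // => m /negbTE->.
by rewrite mul0r.
Qed.

(** The inverse h of g is the opposite monomial, so S_s contains m0 and - m0. *)
Lemma unit_monomial (s : set 'rV[R]_n) (g h : 'cV[int]_n -> R[i]) m0 :
  semigroup_alg s g -> semigroup_alg s h ->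
  (forall t, torus t -> eval_alg g t * eval_alg h t = 1) ->
  (forall t, torus t -> eval_alg g t = t m0) -> perp s m0.
Proof.
move=> [gf gs] [hf hs] gh gE.
have hE t : torus t -> eval_alg h t = t (- m0).
  move=> tt; apply: (mulfI (torus_nz m0 tt)).
  have /torusP [t0 tD] := tt.
  by rewrite -gE // gh // gE // -tD subrr.
apply: perp_dualN; [apply: gs | apply: hs].
  by rewrite (eval_alg_monomial gf gE) oner_neq0.
by rewrite (eval_alg_monomial hf hE) oner_neq0.
Qed.

Lemma eq_eval_alg (s : set 'rV[R]_n) (f x y : 'cV[int]_n -> R[i]) :
  semigroup_alg s f -> (forall m, dual_monoid s m -> x m = y m) ->
  eval_alg f x = eval_alg f y.
Proof.
move=> [_ fs] xy; apply: eq_fsbigr => m _.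
by have [->|/fs/xy ->//] := eqVneq (f m) 0; rewrite !mul0r.
Qed.

Lemma eval_delta m0 (x : 'cV[int]_n -> R[i]) :
  eval_alg (fun m => (m == m0)%:R) x = x m0.
Proof.
rewrite (@eval_algE _ _ [:: m0]) // ?big_seq1 ?eqxx ?mul1r //.
by move=> m; rewrite pnatr_eq0 eqb0 negbK inE.
Qed.

Lemma semigroup_alg_delta (s : set 'rV[R]_n) m0 :
  dual_monoid s m0 -> semigroup_alg s (fun m => (m == m0)%:R).
Proof.
move=> sm0; split=> [|m]; last by rewrite pnatr_eq0 eqb0 negbK => /eqP->.
apply: sub_finite_set (finite_set1 m0) => m /=.
by rewrite pnatr_eq0 eqb0 negbK => /eqP.
Qed.

End Characters.

(** * Orbit closures *)

Section Orbits.
Context {R : realType} {n : nat} (F : fan R n).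
Implicit Types (s t : set 'rV[R]_n) (m : 'cV[int]_n) (x y : toric_point F).

Lemma distinguished_nz s m : distinguished s m != 0 :> R[i] <-> perp s m.
Proof.
rewrite /distinguished; case: asboolP => pm; first by rewrite oner_neq0.
by rewrite eqxx.
Qed.

Lemma chart_torus_distinguished s (t : _ -> R[i]) : torus t ->
  chart s (fun m => t m * distinguished s m : R[i]).
Proof.
move=> /torusP[t0 tD]; split=> [|m m' sm sm'|m sm].
- by rewrite t0 /distinguished asboolT ?mulr1 //; exact: perp0.
- rewrite tD mulrACA; congr (_ * _); rewrite /distinguished -natrM mulnb.
  congr (nat_of_bool _)%:R; apply/asboolP/andP.
    by move=> /(perpD sm sm')[pm pm']; split; apply/asboolP.
  by move=> [/asboolP pm /asboolP pm']; apply/(perpD sm sm').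
- by rewrite /distinguished asboolF ?mulr0 // => /perp_dual.
Qed.

Lemma torus_orbit_point s (t : _ -> R[i]) : cones F s -> torus t ->
  exists2 x, torus_orbit s x &
    pt_val (x : toric_point F) = fun m => t m * distinguished s m.
Proof.
move=> Fs tt.
have [|x xs xE] := chart_orbit_point Fs (chart_torus_distinguished s tt).
  by move=> m; rewrite mulf_eq0 negb_or => /andP[_ /distinguished_nz].
by exists x => //; split=> //; exists t => // m _; rewrite xE.
Qed.

Lemma vanish_on_orbit s f : cones F s -> fin_supp f ->
  (forall x, torus_orbit s x -> eval_alg f (pt_val x) = 0) ->
  forall m, perp s m -> f m = 0.
Proof.
move=> Fs /fin_supp_seq [ms ums fms] f0 m pm.
have [/eqP //|/fms mms] := boolP (f m == 0).
have := @character_independence _ _ ms (fun m => f m * distinguished s m)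
  ums _ m mms.
rewrite {2}/distinguished asboolT // mulr1; apply=> t tt.
have [x xs xE] := torus_orbit_point Fs tt.
rewrite -[RHS](f0 x xs) xE (eval_algE _ ums fms).
by apply: eq_bigr => l _; rewrite mulrAC mulrA.
Qed.

Lemma vanish_at_point s f x : s `<=` pt_cone x ->
  (forall m, perp s m -> f m = 0) -> eval_alg f (pt_val x) = 0.
Proof.
move=> sx f0; apply: fsbig1 => m _.
have [pm|/(pt_val_eq0) ->] := pselect (perp (pt_cone x) m);
  last by rewrite mulr0.
by rewrite f0 ?mul0r //; apply: perpS pm.
Qed.

(** In U_t the locus is cut out by the monomials m such that s is not inside the
    face of t cut out by m. When s is not contained in t, this includes m = 0,
    that is the function 1, and the locus misses U_t as it should. *)
Lemma closed_star s : zariski_closed [set x : toric_point F | s `<=` pt_cone x].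
Proof.
move=> t Ft.
exists [set f | exists2 m, dual_monoid t m /\
    ~ (s `<=` t `&` [set v | pairing (extR m) v = 0]) &
    f = fun m' => (m' == m)%:R].
  by move=> f [m [tm _] ->]; apply: semigroup_alg_delta.
move=> x xt; split=> [/= sx f [m [tm sm] ->]|/= x0].
  rewrite eval_delta; apply: pt_val_eq0 => pm; apply: sm => v sv.
  by split; [apply/xt/sx | apply/pm/sx].
have [m tm pE] := fan_rational_face Ft (pt_cone_fan x) xt.
rewrite pE; apply: contrapT => sN.
have := x0 (fun m' => (m' == m)%:R); rewrite eval_delta => x0m.
have : pt_val x m != 0 by apply/pt_val_nz; rewrite pE => v [].
by rewrite x0m ?eqxx //; exists m.
Qed.

Lemma orbit_closureE s : cones F s ->
  orbit_closure F s = [set x | s `<=` pt_cone x].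
Proof.
move=> Fs; apply/seteqP; split=> [x|x /= sx Y cY sY].
  by apply; [exact: closed_star | move=> y [yE _] /=; rewrite yE].
have [I It IP] := cY _ (pt_cone_fan x).
apply/IP => // f If; apply: (vanish_at_point sx).
have [ff fx] := It f If; apply: vanish_on_orbit => // y ys.
have ya : affine_open (pt_cone x) y.
  by case: ys => yE _; rewrite /affine_open /= yE.
exact: (proj1 (IP y ya) (sY y ys) f If).
Qed.

(** U_s meets U_t in the principal open subset given by a monomial cutting out
    the face common to s and t. *)
Lemma open_affine t : cones F t ->
  zariski_open (affine_open t : set (toric_point F)).
Proof.
move=> Ft s Fs.
have [m sm mE] := rational_face (fan_cone Fs) (fan_meet Fs Ft).
exists [set (fun m' => (m' == m)%:R)].
  by move=> _ ->; apply: semigroup_alg_delta.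
move=> x xs; split=> [xt _ ->|x0 xt].
  rewrite eval_delta; apply: pt_val_eq0 => pm; apply: xt => v xv.
  have : (s `&` t) v; last by case.
  by rewrite mE; split; [apply: xs | apply: pm].
have := x0 _ erefl; rewrite eval_delta => /eqP; apply/negP/pt_val_nz => v xv.
have : (s `&` t) v; last by rewrite mE => -[].
by split; [apply: xs | apply: xt].
Qed.

Lemma sub_zariski_closure (Z : set (toric_point F)) : Z `<=` zariski_closure Z.
Proof. by move=> x Zx Y _; apply. Qed.

Lemma zariski_closure_min (Z Y : set (toric_point F)) :
  zariski_closed Y -> Z `<=` Y -> zariski_closure Z `<=` Y.
Proof. by move=> cY ZY x; apply. Qed.

Lemma open_meets_closure (U Z : set (toric_point F)) :
  zariski_open U -> U `&` zariski_closure Z !=set0 -> U `&` Z !=set0.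
Proof.
move=> oU [x [Ux Zx]]; apply: contrapT => UZ.
have := Zx _ oU; apply => // y Zy Uy; apply: UZ; by exists y.
Qed.

End Orbits.

(** * Rays *)

Section Rays.
Context {R : realType} {n : nat}.
Implicit Types (s t : set 'rV[R]_n) (m : 'cV[int]_n) (v w : 'rV[int]_n).

Lemma extR_eq0 p q (B : 'M[int]_(p, q)) :
  (extR B == 0 :> 'M[R]_(p, q)) = (B == 0).
Proof.
apply/eqP/eqP => [B0|->]; last exact: extR0.
apply/matrixP => i j; rewrite [RHS]mxE; apply/eqP; rewrite -(intr_eq0 R).
by have /matrixP/(_ i j) := B0; rewrite !mxE => ->.
Qed.

Lemma ray_line s v u a : is_cone s -> v != 0 -> s (extR v) -> s u ->
  u = a *: extR v -> 0 <= a.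
Proof.
move=> cs v0 sv su uE; rewrite leNgt; apply/negP => a0.
have : s (- extR v).
  have -> : - extR v = (- a)^-1 *: u.
    by rewrite uE scalerA invrN mulNr mulVf ?lt_eqF // scaleN1r.
  by apply: is_coneZ su => //; rewrite invr_ge0 oppr_ge0 ltW.
by move=> /(cs.2 _ sv)/eqP; rewrite extR_eq0 (negbTE v0).
Qed.

Lemma ray_generated s : is_cone s -> has_dim s 1 ->
  exists v, [/\ v != 0, s (extR v) &
    forall u, s u -> exists2 a, 0 <= a & u = a *: extR v].
Proof.
move=> cs [B [Bfree sB Bs]]; have [[k [G sE]] pt] := cs.
have B0 : B != 0.
  by apply: contraTneq Bfree => ->; rewrite /row_free mxrank0.
have [i Gi0] : exists i, row i G != 0.
  apply: contrapT => G0; case/eqP: B0; have := sB 0; rewrite sE => -[c [_ cB]].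
  have G00 : G = 0.
    apply/row_matrixP => i; rewrite row0.
    by apply: contrapT => /eqP Gi; apply: G0; exists i.
  by apply/row_matrixP => j; rewrite (ord1 j) cB G00 extR0 mulmx0 row0.
exists (row i G); have sGi : s (extR (row i G)).
  by rewrite sE; exact: cone_gen_row.
split=> // u su.
have /sub_rVP [a aE] := Bs _ sGi; have /sub_rVP [b bE] := Bs _ su.
have a0 : a != 0.
  apply: contra_neq Gi0 => a0; apply/eqP; rewrite -extR_eq0; apply/eqP.
  by rewrite aE a0 scale0r.
have uE : u = (b / a) *: extR (row i G) by rewrite aE scalerA divfK.
by exists (b / a) => //; exact: (ray_line cs Gi0 sGi su uE).
Qed.

(** Tested on the functionals v_j e_l - v_l e_j, the hypothesis says that the
    2 x 2 minors of v and w involving column j vanish. *)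
Lemma proportional v w j : v 0 j != 0 ->
  (forall m, v *m m = 0 -> w *m m = 0) ->
  extR w = ((w 0 j)%:~R / (v 0 j)%:~R) *: extR v :> 'rV[R]_n.
Proof.
move=> vj vw; apply/rowP => l; rewrite !mxE.
have mE (u : 'rV[int]_n) :
    u *m (v 0 j *: delta_mx l 0 - v 0 l *: delta_mx j 0) =
    (v 0 j * u 0 l - v 0 l * u 0 j)%:M.
  rewrite mulmxBr -!scalemxAr -!colE.
  by apply/matrixP => a b; rewrite !ord1 !mxE eqxx mulr1n.
have := vw _ (etrans (mE v) _); rewrite mE mulrC subrr raddf0 => /(_ erefl).
move=> /matrixP/(_ 0 0); rewrite !mxE eqxx mulr1n => /eqP.
rewrite subr_eq0 => /eqP E.
have vjR : (v 0 j)%:~R != 0 :> R by rewrite intr_eq0.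
apply: (mulfI vjR); rewrite -intrM E intrM.
by rewrite mulrA mulrCA mulfV // mulr1 mulrC.
Qed.

End Rays.

Section NewRay.
Context {R : realType} {n : nat} (F : fan R n).
Implicit Types (s t : set 'rV[R]_n) (m : 'cV[int]_n) (v w : 'rV[int]_n).

(** Let t be the smallest cone of F between s and s'. A functional which is
    nonnegative on s' and vanishes on s vanishes on t, since it cuts out a face
    of t containing s. As t differs from s, some generator w of t is not on the
    line of s, and w does the job. *)
Lemma new_ray_direction s s' : is_cone s -> has_dim s 1 -> ~ cones F s ->
  cones F s' -> s `<=` s' ->
  exists w m0, [/\ perp s m0, (w *m m0) 0 0 != 0 &
    forall m, dual_monoid s' m -> perp s m -> (w *m m) 0 0 = 0].
Proof.
move=> cs ds Fs Fs' ss'; have [v [v0 sv sP]] := ray_generated cs ds.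
have perp_v m : v *m m = 0 -> perp s m.
  move=> vm u /sP [a _ ->].
  by rewrite pairingZr pairing_int vm mxE mulr0.
have [||t [Ft ts' st] tmin] :=
  @fan_minimal _ _ F [set t | [/\ cones F t, t `<=` s' & s `<=` t]].
- by move=> t [].
- by exists s'; split.
have perp_t m : dual_monoid s' m -> perp s m -> perp t m.
  move=> s'm pm; have tm := dual_monoidS ts' s'm.
  have <- : t `&` [set u | pairing (extR m) u = 0] = t.
    apply: tmin; last exact: subIsetl.
    split; first exact: fan_functional_face.
      exact: subset_trans (@subIsetl _ _ _) ts'.
    by move=> u su; split; [apply: st | apply: pm].
  by move=> u [].
have [j vj] : exists j, v 0 j != 0.
  apply: contrapT => vE; case/eqP: v0; apply/rowP => j; rewrite mxE.
  by apply: contrapT => /eqP vj; apply: vE; exists j.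
have [[k [G tE]] tpt] := fan_cone Ft.
apply: contrapT => wN; apply: Fs; suff -> : s = t by [].
apply/seteqP; split=> // u tu; move: (tu); rewrite tE => -[c [c0 uE]].
(* If no w works, all the generators of t lie on the line of s, so t = s. *)
have GE i : extR (row i G) =
    ((row i G 0 j)%:~R / (v 0 j)%:~R) *: extR v :> 'rV[R]_n.
  apply: proportional => // m vm; apply: contrapT => wm; apply: wN.
  exists (row i G), m; split; first exact: perp_v.
    apply: contra_notN wm => /eqP wm; apply/matrixP => a b.
    by rewrite !ord1 wm mxE.
  move=> m' s'm' pm'; apply/eqP; rewrite -(intr_eq0 R) -pairing_int; apply/eqP.
  by apply: perp_t => //; rewrite tE; exact: cone_gen_row.
have {}uE : u = (\sum_i c 0 i * ((row i G 0 j)%:~R / (v 0 j)%:~R)) *: extR v.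
  rewrite uE mulmx_sum_row scaler_suml; apply: eq_bigr => i _.
  by rewrite row_extR GE scalerA.
have := ray_line (fan_cone Ft) v0 (st _ sv) tu uE.
by rewrite uE => a0; apply: is_coneZ.
Qed.

End NewRay.

(** * The morphism induced by a refinement *)

Section IdMorphism.
Context {R : realType} {n : nat} (F1 F : fan R n).
Implicit Types (s t : set 'rV[R]_n) (m : 'cV[int]_n).
Implicit Types (x : toric_point F1) (y : toric_point F).
Notation f := (@toric_morphism R n n 1%:M F1 F).

Lemma image_cone1 s : image_cone 1%:M s = s.
Proof.
rewrite /image_cone /extR map_mx1; apply/seteqP; split=> [_ [v sv <-]|v sv].
  by rewrite mulmx1.
by exists v => //; rewrite mulmx1.
Qed.

Lemma id_morphismP x y : f x y <->
  exists s, [/\ cones F s, pt_cone x `<=` s, pt_cone y `<=` s &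
    forall m, dual_monoid s m -> pt_val y m = pt_val x m].
Proof.
split=> [] [s [Fs xs ys yx]]; exists s; split=> //.
- by move: xs; rewrite image_cone1.
- by move=> m /yx; rewrite /torus_morphism mul1mx.
- by rewrite image_cone1.
- by move=> m /yx; rewrite /torus_morphism mul1mx.
Qed.

(** The cone of y is cut out in the chart s by a monomial m0 with y(m0) nonzero;
    then x(m0) is nonzero, so m0 annihilates the cone of x. *)
Lemma id_morphism_cone x y : f x y -> pt_cone x `<=` pt_cone y.
Proof.
move=> /id_morphismP [s [Fs xs ys yx]] v xv.
have [m0 sm0 yE] := fan_rational_face Fs (pt_cone_fan y) ys.
rewrite yE; split; first exact: xs.
have : pt_val x m0 != 0 by rewrite -yx //; apply/pt_val_nz; rewrite yE => u [].
by move=> /pt_val_nz; apply.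
Qed.

Lemma id_morphism_exists x s : cones F s -> pt_cone x `<=` s ->
  exists y, [/\ f x y, pt_cone y `<=` s &
    forall m, dual_monoid s m -> pt_val y m = pt_val x m].
Proof.
move=> Fs xs.
pose z m : R[i] := if `[< dual_monoid s m >] then pt_val x m else 0.
have zE m : dual_monoid s m -> z m = pt_val x m.
  by move=> sm; rewrite /z asboolT.
have sz : chart s z.
  split=> [|m m' sm sm'|m sm]; last by rewrite /z asboolF.
    by rewrite zE ?(chart0 (pt_chart x)) //; exact: dual_monoid0.
  rewrite !zE ?(chartD (pt_chart x)) //; last exact: dual_monoidD.
    exact: dual_monoidS sm.
  exact: dual_monoidS sm'.
have [y ys yz] := chart_point Fs sz.
have yx m : dual_monoid s m -> pt_val y m = pt_val x m.
  by move=> sm; rewrite yz ?zE.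
by exists y; split=> //; apply/id_morphismP; exists s.
Qed.

Section CommonCone.
Variables (s : set 'rV[R]_n) (F1s : cones F1 s) (Fs : cones F s).

Lemma id_morphism_lift y : pt_cone y = s ->
  exists x, [/\ pt_cone x = s, pt_val x = pt_val y & f x y].
Proof.
move=> ys; have cy := pt_chart y; rewrite ys in cy.
have [m|x xs xy] := chart_orbit_point F1s cy.
  by move/pt_val_nz; rewrite ys.
exists x; split=> //; apply/id_morphismP; exists s; split=> //.
- by rewrite xs.
- by rewrite ys.
- by move=> m _; rewrite xy.
Qed.

(** Over the orbit of a common cone s, the morphism is injective on the closed
    stratum V(s): x has the cone s, and agrees with y on a chart of F
    that contains U_s. *)
Lemma id_morphism_inj x y : s `<=` pt_cone x -> pt_cone y = s -> f x y ->
  pt_cone x = s /\ pt_val x = pt_val y.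
Proof.
move=> sx ys fxy.
have xs : pt_cone x = s.
  by apply/seteqP; split=> //; rewrite -ys; apply: id_morphism_cone.
split=> //; have /id_morphismP [t [Ft xt yt yx]] := fxy.
rewrite ys in yt; apply: (chart_eq_face (fan_cone Ft) (fan_sub_face Ft Fs yt)).
- by rewrite -xs; apply: pt_chart.
- by rewrite -ys; apply: pt_chart.
- by move=> m /yx.
Qed.

Lemma image_orbit_closure :
  zariski_closure (morph_image f (orbit_closure F1 s)) = orbit_closure F s.
Proof.
apply/seteqP; split; last first.
  move=> y sy Z cZ imZ; apply: sy cZ _ => y' [y's _]; apply: imZ.
  have [x [xs _ fxy]] := id_morphism_lift y's.
  by exists x => //; rewrite orbit_closureE //= xs.
rewrite (orbit_closureE Fs); apply: zariski_closure_min;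
  first exact: closed_star.
move=> y [x]; rewrite orbit_closureE //= => sx /id_morphism_cone.
exact: subset_trans.
Qed.

(** U_s meets V(s) exactly in the orbit of s, over which fibres are singletons.
    Any other open set used to compute the degree meets that orbit as well, so
    1 is the only possible degree. *)
Lemma degree_common : degree f (orbit_closure F1 s) (orbit_closure F s) = 1%N.
Proof.
have fibre y : pt_cone y = s ->
    ([set x | orbit_closure F1 s x /\ f x y] #= `I_1)%card.
  move=> ys; have [x [xs xy fxy]] := id_morphism_lift ys.
  suff -> : [set x | orbit_closure F1 s x /\ f x y] = [set x].
    exact: card_set1.
  rewrite (orbit_closureE F1s).
  apply/seteqP; split=> [x' /= [sx' fx'y]|_ /= ->].
    have [x's x'y] := id_morphism_inj sx' ys fx'y.
    by apply: toric_point_ext; rewrite ?xs ?xy.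
  by split=> //; rewrite xs.
have orbit_meets U : zariski_open U -> U `&` orbit_closure F s !=set0 ->
    exists2 y, U y /\ orbit_closure F s y & pt_cone y = s.
  move=> oU /(open_meets_closure oU) [y [Uy sy]].
  by exists y; [split=> //; exact: sub_zariski_closure | case: sy].
apply: xget_unique => [|d [U [oU /(orbit_meets _ oU) [y Uy ys] Ud]]].
  exists (affine_open s); split; first exact: open_affine.
    have [x sx _] := @torus_orbit_point _ _ F s (one_param 0) Fs
      (torus_one_param 0).
    exists x; split; last exact: sub_zariski_closure.
    by case: sx => xs _; rewrite /affine_open /= xs.
  move=> y [ys]; rewrite orbit_closureE // => sy.
  by apply: fibre; apply/seteqP.
have := card_eq_trans (card_esym (Ud _ Uy)) (fibre _ ys).
by move=> /card_eq_II.
Qed.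

End CommonCone.

(** An open set U that meets the closure of the image contains the image y0 of a
    point x0 of the orbit of s. Translating x0 by the one-parameter subgroup of
    [new_ray_direction] gives infinitely many points of V over y0, so the
    general fibre is not finite and the degree takes its default value. *)
Lemma degree_new s : rays F1 s -> ~ cones F s ->
  let V := orbit_closure F1 s in
  degree f V (zariski_closure (morph_image f V)) = 0%N.
Proof.
move=> [F1s ds] Fs V; apply: xgetPN => d [U [oU]].
move=> /(open_meets_closure oU) [y1 [Uy1 [x1 Vx1 /id_morphismP]]].
move=> [s' [Fs' xs' ys' yx]] Ud.
have sx1 : s `<=` pt_cone x1 by move: Vx1; rewrite /V orbit_closureE.
have ss' := subset_trans sx1 xs'.
have [I Is' IP] := oU _ Fs'.
have [g Ig g1] : exists2 g, I g & eval_alg g (pt_val y1) != 0.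
  apply: contrapT => gN; case: (proj2 (IP y1 ys')) => // g Ig.
  by apply: contrapT => /eqP g1; apply: gN; exists g.
have sg := Is' _ Ig.
(* Otherwise g would vanish on the orbit of s, hence on its closure, at x1. *)
have [x0 sx0 gx0] : exists2 x0 : toric_point F1, torus_orbit s x0 &
    eval_alg g (pt_val x0) != 0.
  apply: contrapT => x0N; case/eqP: g1.
  rewrite (eq_eval_alg sg yx); apply: vanish_at_point sx1 _.
  apply: vanish_on_orbit F1s sg.1 _ => x0 sx0.
  by apply: contrapT => /eqP gx0; apply: x0N; exists x0.
have x0s : pt_cone x0 = s by case: sx0.
have x0s' : pt_cone x0 `<=` s' by rewrite x0s.
have [y0 [fxy0 ys0 yx0]] := id_morphism_exists Fs' x0s'.
have Uy0 : U y0.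
  apply: contrapT => /(IP y0 ys0)/(_ g Ig)/eqP; apply/negP.
  by rewrite (eq_eval_alg sg yx0).
have Vorbit x : pt_cone x = s -> V x by rewrite /V orbit_closureE //= => ->.
have fin : finite_set [set x | V x /\ f x y0].
  exists d; apply: Ud; split=> //; apply: sub_zariski_closure.
  by exists x0 => //; apply: Vorbit.
have [w [m0 [pm0 wm0 wperp]]] := new_ray_direction (fan_cone F1s) ds Fs Fs' ss'.
have mulMn k m : ((w *+ k) *m m) 0 0 = (w *m m) 0 0 *+ k.
  by rewrite -scaler_nat -scalemxAl mxE mulr_natl.
have cx0 := pt_chart x0; rewrite x0s in cx0.
have /choice [xk xkP] k : exists x : toric_point F1, pt_cone x = s /\
    pt_val x = fun m => one_param (w *+ k) m * pt_val x0 m.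
  have [||x xs xE] := @chart_orbit_point _ _ F1 s
    (fun m => one_param (w *+ k) m * pt_val x0 m) F1s.
  - split=> [|m m' sm sm'|m sm].
    + by have /torusP[-> _] := @torus_one_param R n (w *+ k);
        rewrite (chart0 cx0) mulr1.
    + by have /torusP[_ ->] := @torus_one_param R n (w *+ k);
        rewrite (chartD cx0) // mulrACA.
    + by case: cx0 => _ _ -> //; rewrite mulr0.
  - by move=> m; rewrite mulf_eq0 negb_or => /andP[_ /pt_val_nz]; rewrite x0s.
  by exists x.
have xk_inj : injective xk.
  move=> k l /(congr1 (fun x => pt_val x m0)).
  rewrite !(xkP _).2 => /(mulIf (chart_perp_nz cx0 pm0)) /expz2_inj.
  by rewrite !mulMn => /(mulrIn wm0).
have fxk k : f (xk k) y0.
  apply/id_morphismP; exists s'; split=> //; first by rewrite (xkP k).1.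
  move=> m s'm; rewrite yx0 // (xkP k).2.
  have [pm|pm] := pselect (perp s m); last first.
    by rewrite (_ : pt_val x0 m = 0) ?mulr0 //; apply: pt_val_eq0; rewrite x0s.
  by rewrite /one_param mulMn wperp // mul0rn expr0z mul1r.
apply: infinite_nat.
apply: sub_finite_set (@finite_preimage _ _ _ xk _ fin) =>
  [k _ /=|k l _ _ /xk_inj //].
by split=> //; apply: Vorbit; case: (xkP k).
Qed.
End IdMorphism.

(** * Comparison of the divisors *)

(** A cone s1 of the refinement through the generator of s lies in some cone t
    of F; the functional cutting out the face s of t cuts out of s1 a cone of
    the refinement, which must be s. *)
Lemma ray_in_refinement (R : realType) (n : nat) (F1 F : fan R n) s :
  refines F1 F -> rays F s -> cones F1 s.
Proof.
move=> [suppE sub] [Fs ds].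
have [v [_ sv sP]] := ray_generated (fan_cone Fs) ds.
have [s1 F1s1 s1v] : Defs.support F1 (extR v) by rewrite suppE; exists s.
have [t Ft s1t] := sub _ F1s1.
have [u [u0 tsE]] := fan_meet Ft Fs.
suff -> : s = s1 `&` [set w | pairing u w = 0].
  by apply: fan_face F1s1 _; exists u; split=> // w /s1t; apply: u0.
apply/seteqP; split=> [w /sP [a a0 ->]|w [s1w uw]].
  split; first exact: is_coneZ (fan_cone F1s1) a0 s1v.
  have : (t `&` s) (extR v) by split=> //; apply: s1t.
  by rewrite tsE /= pairingZr => -[_ ->]; rewrite mulr0.
have : (t `&` s) w by rewrite tsE; split=> //; apply: s1t.
by case.
Qed.

Lemma support_functionE (R : realType) (n : nat) (F : fan R n)
    (D : cartier F) s v :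
  max_cones F s -> s v ->
  support_function D v = pairing (extR (cartier_data D s)) v.
Proof.
move=> Fs sv.
have [Fs' sv'] := xgetI set0 (conj Fs sv : [set s | max_cones F s /\ s v] s).
exact: cartier_compat.
Qed.

(** On a maximal cone s mapped into s', the two local equations are monomials
    whose quotient is a unit, so their exponents agree on s. *)
Lemma support_function_pullback (R : realType) (n n' : nat)
    (F1 : fan R n) (F' : fan R n') (A : 'M[int]_(n, n'))
    (D : cartier F') (E : cartier F1) v :
  maps_cones A F1 F' -> cartier_pullback A D E -> Defs.support F1 v ->
  support_function E v = support_function D (v *m extR A).
Proof.
move=> AF1 DE [s0 /sub_max_cone[s ms s0s] /s0s sv].
have [s1 /sub_max_cone[s' ms' s1s'] /subset_trans/(_ s1s') ss'] :=
  AF1 _ (proj1 ms).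
rewrite (support_functionE E ms sv) (support_functionE D ms'); last first.
  by apply: ss'; exists v.
have [g [h [sg sh ghE]]] := DE _ _ ms ms' ss'.
set uE := cartier_data E s in ghE *; set uD := cartier_data D s' in ghE *.
have gE t : torus t -> eval_alg g t = t (A *m uD - uE).
  move=> tt; have [_ tD] := (torusP t).1 tt.
  have [_] := ghE t tt; rewrite /character /torus_morphism => tuE.
  rewrite tD tuE mulrCA -tD mulmxN subrr.
  by rewrite ((torusP t).1 tt).1 mulr1.
have := unit_monomial sg sh (fun t tt => (ghE t tt).1) gE sv.
rewrite extRD extRN extR_mul pairingDl pairingNl -pairing_mul => /eqP.
by rewrite subr_eq0 => /eqP.
Qed.

(** Exchanging the sums turns the sum over the prime cycles occurring in a
    divisor, which defines a push-forward, into a sum over the rays. *)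
Lemma fsum_prime_cycles (S T : choiceType) (A : set S) (P : set T) (V : S -> T)
    (c : S -> int) (g : T -> int) : finite_set A ->
  \sum_(t \in P) (\sum_(s \in A) c s * (`[< t = V s >])%:R) * g t =
  \sum_(s \in A) c s * (g (V s) * (`[< P (V s) >])%:R).
Proof.
move=> fA; have fVA : finite_set (V @` A) by apply: finite_image.
rewrite -(fsbig_widen (P `&` V @` A) P); first last.
- move=> t [Pt nt] /=; rewrite fsbig1 ?mul0r // => s As.
  by rewrite asboolF ?mulr0 // => tV; apply: nt; split=> //; exists s.
- exact: subIsetl.
under eq_fsbigr do rewrite mulr_fsuml.
rewrite exchange_fsbig //=; last exact: finite_setIr.
apply: eq_fsbigr => s; rewrite inE => As.
case: asboolP => PV; last first.
  rewrite !mulr0 fsbig1 // => t [Pt _]; rewrite asboolF ?mulr0 ?mul0r // => tV.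
  by apply: PV; rewrite -tV.
rewrite -(fsbig_widen [set V s] (P `&` V @` A)).
- by rewrite fsbig_set1 asboolT // !mulr1.
- by move=> _ ->; split=> //; exists s.
- by move=> t [_ /= tV]; rewrite asboolF // mulr0 mul0r.
Qed.

Theorem theorem4p1 (R : realType) (n n' : nat)
    (Sigma : fan R n) (Sigma' : fan R n')
    (Sigma_complete : complete Sigma) (Sigma'_complete : complete Sigma')
    (A : 'M[int]_(n, n')) (A_surj : row_full (extR A : 'M[R]_(n, n')))
    (D : cartier Sigma')
    (* any refinement used to compute f_A^* D, and the pull back of D to it *)
    (SigmaT : fan R n) (SigmaT_refines : refines SigmaT Sigma)
    (A_SigmaT : maps_cones A SigmaT Sigma')
    (E : cartier SigmaT) (E_pullback : cartier_pullback A D E) :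
  pushforward (@toric_morphism R n n 1%:M SigmaT Sigma) (weil_of_cartier E) =
  toric_weil Sigma
    (fun tau => - support_function_lattice D (ray_generator tau *m A)).
Proof.
have fT : finite_set (rays SigmaT).
  by apply: sub_finite_set (fan_finite SigmaT) => s [].
apply: funext => Z.
rewrite /pushforward /weil_of_cartier /toric_weil /prime_cycle.
rewrite fsum_prime_cycles //.
have raysS : rays Sigma `<=` rays SigmaT.
  by move=> s rs; split; [apply: ray_in_refinement rs | case: rs].
(* The rays of the refinement that are not in Sigma are contracted. *)
rewrite -(fsbig_widen _ _ _ raysS); last first.
  move=> s [rs nrs]; have ns : ~ cones Sigma s by case: rs => ? ? ?; apply: nrs.
  rewrite /=; case: asboolP => [<-|_]; last by rewrite !mulr0.
  by rewrite (degree_new rs ns) mul0r mulr0.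
apply: eq_fsbigr => s; rewrite inE => rs; have [Fs _] := rs.
have [FTs _] := raysS _ rs.
rewrite /= image_orbit_closure //.
have -> : support_function_lattice E (ray_generator s) =
    support_function_lattice D (ray_generator s *m A).
  rewrite /support_function_lattice extR_mul.
  rewrite (support_function_pullback A_SigmaT E_pullback) //.
  (* The default value 0 of a ray generator also belongs to the cone. *)
  exists s => //; rewrite /ray_generator; case: xgetP => [v _ []//|_].
  by rewrite extR0; apply: is_cone0 (fan_cone Fs).
have [<-|ZV] := pselect (orbit_closure Sigma s = Z).
  by rewrite !asboolT //= degree_common.
by rewrite !asboolF ?mulr0 //= => /esym.
Qed.
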